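(* Let $\alpha\in[0,1]$, and let $G$ be a connected unicyclic graph on $n$ vertices with girth $g\ge 3$. Then $$\rho_\alpha(G)\le \rho_\alpha(U_n(g)),$$ and equality holds if and only if $G\cong U_n(g)$.
   Context: All graphs are finite, simple and connected. For a graph $G$ with adjacency matrix $A(G)$ and diagonal degree matrix $D(G)$, put $A_\alpha(G)=\alpha D(G)+(1-\alpha)A(G)$ for $\alpha\in[0,1]$; $\rho_\alpha(G)$ denotes the largest eigenvalue of $A_\alpha(G)$. A connected graph is unicyclic if it has exactly one cycle (equivalently, its number of edges equals its number of vertices); its girth is the length of that cycle. $U_n(g)$ denotes the unicyclic graph of order $n$ consisting of a cycle of length $g$ with $n-g$ pendant vertices (vertices of degree $1$) all attached to one single vertex of the cycle (for $n=g$, it is the cycle itself). *)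

(* Defs.v *)
From HB Require Import structures.
From mathcomp Require Import all_boot all_order all_algebra.
From mathcomp Require Import classical_sets reals complex polyrcf.

Set Implicit Arguments.
Unset Strict Implicit.
Unset Printing Implicit Defensive.

Import Order.TTheory GRing.Theory Num.Theory.
Local Open Scope ring_scope.

Record sgraph := SGraph {
  vertex :> finType;
  adj : rel vertex;
  adj_sym : symmetric adj;
  adj_irr : irreflexive adj }.

Definition connected_graph (G : sgraph) : Prop :=
  forall x y : G, connect (@adj G) x y.

Definition deg (G : sgraph) (x : G) : nat := #|adj x|.

Definition graph_iso (G H : sgraph) : Prop :=
  exists f : G -> H, bijective f /\ forall x y : G, adj (f x) (f y) = adj x y.

(* The bound on the size excludes the degenerate closed walks [:: x; y] along
   an edge. *)
Definition graph_cycle (G : sgraph) (c : seq G) : bool :=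
  (2 < size c)%N && ucycleb (@adj G) c.

(* Distinct sequences can run through the same cycle of G (with another
   starting point or direction); the set of edges identifies the cycle as a
   subgraph. *)
Definition cycle_edges (G : sgraph) (c : seq G) : {set {set G}} :=
  [set [set x; next c x]%SET | x in c]%SET.

Definition unicyclic (G : sgraph) : Prop :=
  connected_graph G /\
  exists2 c : seq G, graph_cycle c &
    forall c' : seq G, graph_cycle c' -> cycle_edges c' = cycle_edges c.

(* Girth as the length of a shortest cycle; when G is unicyclic this is the
   length of its only cycle. *)
Definition has_girth (G : sgraph) (g : nat) : Prop :=
  (exists2 c : seq G, graph_cycle c & size c = g) /\
  forall c : seq G, graph_cycle c -> (g <= size c)%N.

Section Ungraph.
Variables n g : nat.

(* The vertices 0, ..., g-1 form the cycle, and g, ..., n-1 are the pendant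
   vertices, all attached to 0. *)
Definition Un_arc (u v : 'I_n) : bool :=
  [&& (u < g)%N, (v < g)%N & val v == (u.+1 %% g)%N] ||
  ((val u == 0%N) && (g <= v)%N).

(* The condition u != v only matters when g = 1, where it removes a loop. *)
Definition Un_adj (u v : 'I_n) : bool :=
  (u != v) && (Un_arc u v || Un_arc v u).

Lemma Un_adj_sym : symmetric Un_adj.
Proof. by move=> u v; rewrite /Un_adj eq_sym orbC. Qed.

Lemma Un_adj_irr : irreflexive Un_adj.
Proof. by move=> u; rewrite /Un_adj eqxx. Qed.

(* This is the graph U_n(g) for 3 <= g <= n. *)
Definition Un : sgraph := SGraph Un_adj_sym Un_adj_irr.

End Ungraph.

Section Alpha.
Variables (R : realType) (G : sgraph).

Definition adjmx : 'M[R]_#|G| :=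
  \matrix_(i, j) (adj (enum_val i) (enum_val j))%:R.

Definition degmx : 'M[R]_#|G| :=
  diag_mx (\row_i (deg (enum_val i))%:R).

Definition Aalpha (alpha : R) : 'M[R]_#|G| :=
  alpha *: degmx + (1 - alpha) *: adjmx.

End Alpha.

(* The supremum of the set of real eigenvalues; [max_eigenvalueP] below shows
   that it is a maximum for symmetric matrices of positive size. *)
Definition max_eigenvalue (R : realType) (m : nat) (A : 'M[R]_m) : R :=
  sup [set a : R | eigenvalue A a]%classic.

Definition rho (R : realType) (alpha : R) (G : sgraph) : R :=
  max_eigenvalue (Aalpha G alpha).

Lemma eigenvalue_sym_ex (R : realType) (m : nat) (A : 'M[R]_m) :
  (0 < m)%N -> A^T = A -> exists a, eigenvalue A a.
Proof.
move=> m0 sA; pose B := map_mx (real_complex R) A.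
have [|l rl] := @closed_rootP _ (char_poly B) _.
  by rewrite size_char_poly; case: (m) m0.
have /eigenvalueP[v vB v0] : eigenvalue B l by rewrite eigenvalue_root_char.
pose w := map_mx (Num.conj : R[i] -> R[i]) v.
have Bc : map_mx (Num.conj : R[i] -> R[i]) B = B.
  by apply/matrixP => i j; rewrite !mxE; congr (_ +i* _)%C; rewrite oppr0.
have sB : B^T = B by rewrite /B -[in RHS]sA; apply/matrixP => i j; rewrite !mxE.
have wB : w *m B = l^* *: w by rewrite -Bc -map_mxM vB map_mxZ.
have s0 : (v *m w^T) 0 0 != 0.
  apply: contraNneq v0 => s0; apply/eqP/rowP => i; rewrite mxE.
  move: s0; rewrite mxE => /eqP; rewrite psumr_eq0; last first.
    by move=> j _; rewrite !mxE mul_conjC_ge0.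
  by move=> /allP/(_ i (mem_index_enum _)); rewrite !mxE mul_conjC_eq0 => /eqP.
have ll : l = l^*.
  have : v *m B *m w^T = v *m (w *m B)^T by rewrite trmx_mul sB mulmxA.
  rewrite vB wB -scalemxAl linearZ /= -scalemxAr.
  move=> /matrixP /(_ 0 0); rewrite mxE [RHS]mxE; exact: (mulIf s0).
have [a la] : exists a, l = real_complex R a.
  move: ll; clear; case: l => x y ll; exists x.
  have /eqP : y = - y by case: ll.
  by rewrite -addr_eq0 -mulr2n mulrn_eq0 /= => /eqP ->.
by exists a; move: rl; rewrite la eigenvalue_root_char -map_char_poly fmorph_root.
Qed.

Lemma max_eigenvalueP (R : realType) (m : nat) (A : 'M[R]_m) :
  (0 < m)%N -> A^T = A ->
  eigenvalue A (max_eigenvalue A) /\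
  forall a, eigenvalue A a -> a <= max_eigenvalue A.
Proof.
move=> m0 /(eigenvalue_sym_ex m0)[b eb].
pose s := rootsR (char_poly A).
have p0 : char_poly A != 0 by rewrite monic_neq0 ?char_poly_monic.
have es a : eigenvalue A a = (a \in s).
  by rewrite eigenvalue_root_char -roots_on_rootsR.
pose M := \big[Order.max/b]_(a <- s) a.
have Ms : M \in s.
  rewrite /M big_seq; elim/big_ind: _ => [|x y|//]; first by rewrite -es.
  by case: (leP x y).
have leM a : a \in s -> a <= M by move=> as_; apply: le_bigmax_seq.
suff -> : max_eigenvalue A = M by split=> [|a]; rewrite es //; apply: leM.
apply/eqP; rewrite eq_le; apply/andP; split.
  by apply: ge_sup; [exists b | move=> a /=; rewrite es; apply: leM].
apply: ub_le_sup; last by rewrite /= es.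
by exists M => a /=; rewrite es; apply: leM.
Qed.

Lemma Aalpha_sym (R : realType) (G : sgraph) (alpha : R) :
  (Aalpha G alpha)^T = Aalpha G alpha.
Proof.
apply/matrixP => i j; rewrite !mxE adj_sym; congr (_ * _ + _).
by rewrite eq_sym; case: eqVneq => [->|_]; rewrite ?mulr0n.
Qed.

Lemma rhoP (R : realType) (alpha : R) (G : sgraph) :
  (0 < #|G|)%N ->
  eigenvalue (Aalpha G alpha) (rho alpha G) /\
  forall a, eigenvalue (Aalpha G alpha) a -> a <= rho alpha G.
Proof. by move=> G0; apply: max_eigenvalueP => //; apply: Aalpha_sym. Qed.

(* Main.v *)
Require Import Defs.
From mathcomp Require Import all_boot perm all_order all_algebra reals complex.
From mathcomp Require Import ring zify.

Set Implicit Arguments.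
Unset Strict Implicit.
Unset Printing Implicit Defensive.

Import Order.TTheory GRing.Theory Num.Theory.
Local Open Scope ring_scope.

(** Let [x >= 0] be an eigenfunction of [G] for [rho alpha G], let [u] be a vertex
    where [x] is maximal, and let [r] be the vertex of the cycle [c] nearest to
    [u].  Put [u] in the place of [r] on the cycle and attach every remaining
    vertex to [u]: on the vertex set of [G] this gives a copy of [U_n(g)].  Each
    edge outside [c] is a bridge, hence has an end far from [u], and that end
    determines the edge; replacing its near end by [u] (and [r] by [u] on the
    cycle) does not decrease any term of the quadratic form
    [\sum_(edges vw) (alpha (x_v^2 + x_w^2) + 2 (1 - alpha) x_v x_w)].  By the
    Rayleigh principle [rho] does not decrease.  If it stays the same, then [x]
    is an eigenfunction of both graphs for the same eigenvalue.  The neighbours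
    of [u] in [G] are also neighbours of [u] in the new graph, so comparing the two
    eigenvalue equations at [u] shows that [u] has the same neighbours in both,
    which forces the graphs to coincide. *)

(** * The Rayleigh principle *)

Section Rayleigh.
Local Open Scope sesquilinear_scope.

(** In a unitary eigenbasis over the complex numbers both sides are sums of [|z_i|^2], weighted by
    the eigenvalues [d_i] and by [M]. Equality forces [z_i = 0] wherever [d_i] differs from [M]. *)
Lemma rayleigh_leif (R : realType) (m : nat) (A : 'M[R]_m) (M : R) (x : 'rV_m) :
  A^T = A -> (forall a, eigenvalue A a -> a <= M) ->
  (x *m A *m x^T) 0 0 <= M * (x *m x^T) 0 0 ?= iff (x *m A == M *: x).
Proof.
move=> sA leM; pose c := real_complex R; pose B := map_mx c A.
have Bh : B \is hermsymmx.
  apply: realsym_hermsym.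
    by apply/is_hermitianmxP; rewrite expr0 scale1r map_mx_id // map_trmx sA.
  by apply/mxOverP => i j; rewrite mxE /c complex_real.
have := hermitian_normalmx Bh => /orthomx_spectralP.
have := hermitian_spectral_diag_real Bh.
have := spectral_unitarymx B; rewrite -/B.
move: (spectralmx B) (spectral_diag B) => P d Pu dr BE.
have Pi := unitarymx_unit Pu.
have ledM i : d 0 i <= c M.
  have /complex_realP[a da] : d 0 i \is Num.real by move/mxOverP: dr; apply.
  rewrite da lecR; apply: leM.
  (* The eigenvector at hand, row [i] of [P], is complex; the characteristic polynomial brings the
     eigenvalue back to [A]. *)
  rewrite eigenvalue_root_char -(fmorph_root c) map_char_poly -/B.
  rewrite -eigenvalue_root_char; apply/eigenvalueP; exists (row i P).
    rewrite BE -!row_mul !mulmxA mulmxV // mul1mx.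
    by rewrite row_mul row_diag_mx -scalemxAl -rowE da.
  apply/negP => /eqP P0; have := mulmxV Pi.
  move=> /(congr1 (row i)) /rowP /(_ i) /eqP.
  by rewrite row_mul P0 mul0mx !mxE eqxx eq_sym oner_eq0.
pose w := map_mx c x; pose z := w *m P^t*.
have zP : z *m P = w by rewrite /z -invmx_unitary // mulmxKV.
have wt : w^t* = map_mx c x^T.
  by apply/matrixP => i j; rewrite !mxE; apply: conjc_real.
have zt : P *m w^t* = z^t*.
  by rewrite /z trmx_mul map_mxM /= trmxCK.
have ww : c ((x *m x^T) 0 0) = \sum_i `|z 0 i| ^+ 2.
  transitivity ((w *m w^t*) 0 0); first by rewrite wt -map_mxM [RHS]mxE.
  rewrite -{1}zP -mulmxA zt mxE; apply: eq_bigr => i _.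
  by rewrite !mxE normCK.
have wBw : c ((x *m A *m x^T) 0 0) = \sum_i d 0 i * `|z 0 i| ^+ 2.
  transitivity ((w *m B *m w^t*) 0 0); first by rewrite wt -!map_mxM [RHS]mxE.
  rewrite BE -!mulmxA zt !mulmxA invmx_unitary // -/z mxE; apply: eq_bigr => i _.
  by rewrite mul_mx_diag !mxE normCK -mulrA mulrCA.
have le i : true -> d 0 i * `|z 0 i| ^+ 2 <= c M * `|z 0 i| ^+ 2
    ?= iff ((c M - d 0 i) * z 0 i == 0).
  move=> _; split; first by rewrite ler_wpM2r ?exprn_ge0.
  rewrite -subr_eq0 -mulrBl [LHS]mulf_eq0 [RHS]mulf_eq0 expf_eq0 normr_eq0 /=.
  by rewrite subr_eq0 [in RHS]subr_eq0 eq_sym.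
have := leif_sum le; rewrite -wBw -mulr_sumr -ww -rmorphM => -[le1 eq1].
split; first by rewrite -lecR.
rewrite -(inj_eq (@complexI R)) eq1; apply/forallP/eqP => [h|h i].
  apply: (map_mx_inj (f := real_complex R)).
  rewrite map_mxM map_mxZ -/c -/B -/w BE !mulmxA invmx_unitary // -/z -zP.
  rewrite scalemxAl; congr (_ *m _); apply/rowP => i; rewrite mul_mx_diag mxE [RHS]mxE.
  by have := h i; rewrite /= mulrBl subr_eq0 => /eqP ->; rewrite mulrC.
have : w *m B = c M *: w by rewrite -map_mxM h map_mxZ.
rewrite {1}BE !mulmxA invmx_unitary // -/z -zP scalemxAl.
move=> /(congr1 (mulmx^~ (invmx P))).
rewrite !mulmxK // mul_mx_diag => /rowP/(_ i); rewrite mxE [RHS]mxE => hi.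
by rewrite /= mulrBl -hi mulrC subrr.
Qed.

End Rayleigh.

(** * The quadratic form of [Aalpha] on functions of the vertices *)

Definition Aalpha_op (R : realType) (G : sgraph) (alpha : R) (x : G -> R) (v : G) : R :=
  \sum_(w | adj v w) (alpha * x v + (1 - alpha) * x w).

Definition energy (R : realType) (G : sgraph) (alpha : R) (x : G -> R) : R :=
  \sum_v x v * Aalpha_op alpha x v.

Definition edge_energy (R : realType) (alpha a b : R) : R :=
  alpha * (a ^+ 2 + b ^+ 2) + (1 - alpha) * (a * b) *+ 2.

Section Energy.
Variables (R : realType) (alpha : R) (G : sgraph).
Implicit Type x : G -> R.

Let rowf x : 'rV[R]_#|G| := \row_i x (enum_val i).

Lemma rowf_Aalpha x i :
  (rowf x *m Aalpha G alpha) 0 i = Aalpha_op alpha x (enum_val i).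
Proof.
rewrite /Aalpha mulmxDr -!scalemxAr !mxE /Aalpha_op big_split /= sumr_const.
rewrite -mulr_sumr; congr (_ + _ * _).
  rewrite (bigD1 i) //= big1 => [|j ji]; last by rewrite !mxE (negPf ji) mulr0.
  by rewrite !mxE eqxx mulr1n addr0 mulr_natr mulrnAr.
rewrite (reindex (enum_val : 'I_#|G| -> G)) /=; last first.
  by exists enum_rank => ? _; rewrite (enum_valK, enum_rankK).
rewrite [RHS]big_mkcond; apply: eq_bigr => j _; rewrite !mxE adj_sym.
by case: ifP => _; rewrite ?mulr1 ?mulr0.
Qed.

Lemma rowf_energy x :
  (rowf x *m Aalpha G alpha *m (rowf x)^T) 0 0 = energy alpha x.
Proof.
rewrite mxE /energy (reindex (enum_val : 'I_#|G| -> G)) /=; last first.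
  by exists enum_rank => ? _; rewrite (enum_valK, enum_rankK).
by apply: eq_bigr => i _; rewrite rowf_Aalpha !mxE mulrC.
Qed.

Lemma rowf_norm x : (rowf x *m (rowf x)^T) 0 0 = \sum_v x v ^+ 2.
Proof.
rewrite mxE (reindex (enum_val : 'I_#|G| -> G)) /=; last first.
  by exists enum_rank => ? _; rewrite (enum_valK, enum_rankK).
by apply: eq_bigr => i _; rewrite !mxE.
Qed.

Lemma rho_leif x : (0 < #|G|)%N ->
  energy alpha x <= rho alpha G * \sum_v x v ^+ 2
  ?= iff [forall v, Aalpha_op alpha x v == rho alpha G * x v].
Proof.
move=> G0; rewrite -rowf_energy -rowf_norm.
have [_ leM] := rhoP alpha G0.
have := rayleigh_leif (rowf x) (Aalpha_sym G alpha) leM.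
suff -> : (rowf x *m Aalpha G alpha == rho alpha G *: rowf x) =
  [forall v, Aalpha_op alpha x v == rho alpha G * x v] by [].
apply/eqP/forallP => [/rowP h v|h].
  by have := h (enum_rank v); rewrite rowf_Aalpha !mxE enum_rankK => ->.
by apply/rowP => i; rewrite rowf_Aalpha !mxE; apply/eqP.
Qed.

Lemma rho_eigenfunction : (0 < #|G|)%N ->
  exists2 x : G -> R, exists v, x v != 0 &
    forall v, Aalpha_op alpha x v = rho alpha G * x v.
Proof.
move=> /(rhoP alpha)[/eigenvalueP[v vA v0] _].
pose x (u : G) := v 0 (enum_rank u).
have xv : rowf x = v by apply/rowP => i; rewrite mxE /x enum_valK.
exists x => [|u].
  by have /rV0Pn[i vi] := v0; exists (enum_val i); rewrite /x enum_valK.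
by rewrite -[u]enum_rankK -rowf_Aalpha xv vA mxE /x !enum_rankK.
Qed.

(** The sum over ordered pairs meets each edge twice, so doubling the energy avoids choosing an
    orientation. *)
Lemma energyE x :
  energy alpha x *+ 2 = \sum_v \sum_(w | adj v w) edge_energy alpha (x v) (x w).
Proof.
have E : energy alpha x =
    \sum_v \sum_(w | adj v w) (alpha * x v ^+ 2 + (1 - alpha) * (x v * x w)).
  apply: eq_bigr => v _; rewrite mulr_sumr; apply: eq_bigr => w _; ring.
(* In the second copy the ends of each edge trade roles, which makes the summand symmetric. *)
rewrite mulr2n {1}E {}E [X in _ + X](exchange_big_dep xpredT) //= -big_split /=.
apply: eq_bigr => v _.
rewrite [X in _ + X](eq_bigl (fun w => adj v w)) => [|w]; last by rewrite adj_sym.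
by rewrite -big_split /=; apply: eq_bigr => w _; rewrite /edge_energy; ring.
Qed.

Lemma energy_norm x : 0 <= alpha <= 1 ->
  energy alpha x <= energy alpha (fun v => `|x v|).
Proof.
move=> /andP[a0 a1]; rewrite -(ler_pMn2r (isT : 0 < 2)%N) !energyE.
apply: ler_sum => v _; apply: ler_sum => w _; rewrite /edge_energy -!normrX.
rewrite !(ger0_norm (sqr_ge0 _)) lerD2l lerMn2r ler_wpM2l ?subr_ge0 //.
by rewrite -normrM ler_norm.
Qed.

(** Absolute values keep the norm of an eigenfunction and do not lower its energy, so they attain
    the Rayleigh bound again. *)
Lemma rho_nneg_eigenfunction : 0 <= alpha <= 1 -> (0 < #|G|)%N ->
  exists x : G -> R, [/\ forall v, 0 <= x v, exists v, 0 < x v &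
    forall v, Aalpha_op alpha x v = rho alpha G * x v].
Proof.
move=> ha G0; have [x [v xv] xE] := rho_eigenfunction G0.
pose y v := `|x v|; exists y; split=> [w||]; first exact: normr_ge0.
  by exists v; rewrite normr_gt0.
have [le_y eq_y] := rho_leif y G0.
suff : energy alpha y == rho alpha G * \sum_v y v ^+ 2.
  by rewrite eq_y => /forallP h w; apply/eqP.
rewrite eq_le le_y /=; apply: le_trans (energy_norm x ha).
rewrite /energy mulr_sumr; apply: ler_sum => w _; rewrite xE [leRHS]mulrCA -expr2.
by rewrite /y real_normK ?num_real.
Qed.

End Energy.

(** * Invariance of [rho] under isomorphism *)

Lemma graph_iso_energy (R : realType) (alpha : R) (G H : sgraph)
    (f : G -> H) (x : H -> R) :
  bijective f -> (forall u v, adj (f u) (f v) = adj u v) ->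
  energy alpha (x \o f) = energy alpha x.
Proof.
move=> bf fE; rewrite /energy [RHS](reindex f) /=; last exact: onW_bij.
apply: eq_bigr => v _; congr (_ * _); rewrite /Aalpha_op [RHS](reindex f) /=.
  by apply: eq_bigl => w; rewrite fE.
exact: onW_bij.
Qed.

Lemma graph_iso_rho_le (R : realType) (alpha : R) (G H : sgraph) :
  (0 < #|G|)%N -> graph_iso G H -> rho alpha H <= rho alpha G.
Proof.
move=> G0 [f [bf fE]].
have H0 : (0 < #|H|)%N by rewrite -(bij_eq_card bf).
have [x [v xv] xE] := rho_eigenfunction alpha H0.
have x0 : 0 < \sum_v x v ^+ 2.
  rewrite (bigD1 v) //= ltr_wpDr ?exprn_even_gt0 // sumr_ge0 // => *.
  exact: sqr_ge0.
have [+ _] := rho_leif alpha (x \o f) G0.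
rewrite (graph_iso_energy _ _ bf fE).
have -> : energy alpha x = rho alpha H * \sum_v x v ^+ 2.
  by apply/eqP; rewrite (rho_leif alpha x H0).2; apply/forallP => w; rewrite xE.
suff -> : \sum_v (x \o f) v ^+ 2 = \sum_v x v ^+ 2 by rewrite ler_pM2r.
by rewrite [RHS](reindex f) //; apply: onW_bij.
Qed.

Lemma graph_iso_sym (G H : sgraph) : graph_iso G H -> graph_iso H G.
Proof.
case=> f [[g fK gK] fE]; exists g; split; first by exists f.
by move=> x y; rewrite -fE !gK.
Qed.

Lemma graph_iso_rho (R : realType) (alpha : R) (G H : sgraph) :
  (0 < #|G|)%N -> graph_iso G H -> rho alpha G = rho alpha H.
Proof.
move=> G0 GH; have [f [bf _]] := GH; apply/eqP; rewrite eq_le.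
rewrite !graph_iso_rho_le //; first by rewrite -(bij_eq_card bf).
exact: graph_iso_sym.
Qed.

(** * A cycle with pendant vertices *)

Section Next.
Variables (T : eqType) (s : seq T) (us : uniq s).

(** Turns [next] into the successor modulo the length, the form used in [Un_arc]. *)
Lemma index_next (x : T) : x \in s -> index (next s x) s = ((index x s).+1 %% size s)%N.
Proof.
move=> xs; rewrite next_nth xs; case: s us xs => [//|y p] up xp.
have ltx : (index x (y :: p) < (size p).+1)%N by move: xp; rewrite -index_mem.
have [lt|ge] := ltnP (index x (y :: p)) (size p).
  rewrite modn_small // (_ : nth y p _ = nth y (y :: p) (index x (y :: p)).+1) //.
  by rewrite index_uniq.
have -> : index x (y :: p) = size p by apply/eqP; rewrite eqn_leq ge -ltnS ltx.
by rewrite nth_default // index_head modnn.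
Qed.

Lemma next_neq (x : T) : (1 < size s)%N -> x \in s -> next s x != x.
Proof.
move=> s1 xs; apply/eqP => /(congr1 (index^~ s)); rewrite index_next //.
have := xs; rewrite -index_mem leq_eqVlt => /orP[/eqP E|lt].
  by rewrite E modnn => E0; move: E s1; rewrite -E0 => <-.
by rewrite modn_small // => /esym/n_Sn.
Qed.

Lemma next_next_neq (x : T) : (2 < size s)%N -> x \in s -> next s (next s x) != x.
Proof.
move=> s2 xs; apply/eqP => /(congr1 (index^~ s)).
rewrite !index_next ?mem_next //.
have := xs; rewrite -index_mem leq_eqVlt => /orP[/eqP E|lt].
  by rewrite E modnn modn_small ?(ltnW s2) // => E0; move: E s2; rewrite -E0 => <-.
rewrite [(_.+1 %% _)%N in X in (X %% _)%N]modn_small //.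
move: lt; rewrite leq_eqVlt => /orP[/eqP E|lt].
  by rewrite E modnn => E0; move: E s2; rewrite -E0 => <-.
by rewrite modn_small //; lia.
Qed.

End Next.

Section Sun.
Variables (T : finType) (s : seq T) (u : T).

(** [U_n(g)] is rebuilt on a given vertex type, so that one function [x] can be tested on both
    graphs. Arcs run along [s] and from [u] to the pendant vertices. *)
Definition sun_arc (x y : T) : bool :=
  (x \in s) && (y == next s x) || (x == u) && (y \notin s).

Definition sun_adj (x y : T) : bool :=
  (x != y) && (sun_arc x y || sun_arc y x).

Lemma sun_adj_sym : symmetric sun_adj.
Proof. by move=> x y; rewrite /sun_adj eq_sym orbC. Qed.

Lemma sun_adj_irr : irreflexive sun_adj.
Proof. by move=> x; rewrite /sun_adj eqxx. Qed.

Definition sun : sgraph := SGraph sun_adj_sym sun_adj_irr.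

Hypotheses (us : uniq s) (su : u \in s).

(** The isomorphism is the index in the list [L]: the cycle rotated to start at [u], then all other
    vertices. *)
Lemma sun_iso_Un : graph_iso sun (Un #|T| (size s)).
Proof.
have [i p Ep] := rot_to su.
pose L := (u :: p) ++ [seq v <- enum T | v \notin s].
have memp : u :: p =i s by move=> v; rewrite -Ep mem_rot.
have up : uniq (u :: p) by rewrite -Ep rot_uniq.
have szp : size (u :: p) = size s by rewrite -Ep size_rot.
have nextp : next (u :: p) =1 next s by move=> v; rewrite -Ep next_rot.
have uL : uniq L.
  rewrite cat_uniq up filter_uniq ?enum_uniq // andbT.
  by apply/hasPn => v; rewrite mem_filter memp => /andP[].
have memL v : v \in L.
  by rewrite mem_cat memp mem_filter mem_enum andbT orbN.
have sL : size L = #|T|.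
  by rewrite -(card_uniqP uL); apply: eq_card => v; rewrite memL.
have ltL v : (index v L < #|T|)%N by rewrite -sL index_mem.
pose f (v : T) : 'I_#|T| := Ordinal (ltL v).
have f_inj : injective f.
  move=> v w /(congr1 val) fvw; have E : index v L = index w L := fvw.
  by rewrite -(nth_index u (memL v)) E nth_index.
have fs v : (f v < size s)%N = (v \in s).
  rewrite (_ : f v = index v L :> nat) // index_cat memp -szp.
  case: ifP => [vs|vs]; first by rewrite index_mem memp.
  by rewrite ltnNge leq_addr.
have fidx v : v \in s -> f v = index v (u :: p) :> nat.
  by move=> vs; rewrite (_ : f v = index v L :> nat) // index_cat memp vs.
have f0 v : (val (f v) == 0%N) = (v == u).
  have <- : val (f u) = 0%N by rewrite /= eqxx.
  by rewrite (inj_eq val_inj) (inj_eq f_inj).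
have arcE v w : Un_arc (size s) (f v) (f w) = sun_arc v w.
  rewrite /Un_arc /sun_arc !fs f0 [(size s <= _)%N]leqNgt fs; congr (_ || _).
  case vs: (v \in s); rewrite ?andFb //.
  rewrite [LHS]andTb [RHS]andTb; apply/andP/eqP => [[ws /eqP]|->].
    rewrite !fidx // -szp -index_next ?memp // nextp => E.
    by apply/f_inj/val_inj; rewrite E; apply/esym/fidx; rewrite mem_next.
  rewrite mem_next vs [val _]fidx ?mem_next // fidx // -szp -nextp.
  by rewrite index_next ?memp.
exists f; split; last first.
  by move=> v w; rewrite /adj /= /Un_adj /sun_adj (inj_eq f_inj) !arcE.
by apply: inj_card_bij => //; rewrite card_ord.
Qed.

Lemma sun_arc_excl (x y : T) : (2 < size s)%N -> sun_arc x y -> ~~ sun_arc y x.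
Proof.
move=> s2 /orP[/andP[xs /eqP ->]|/andP[/eqP -> ys]].
  rewrite /sun_arc mem_next xs /= negb_or negb_and orbT andbT.
  by rewrite eq_sym next_next_neq.
by rewrite /sun_arc su andbF orbF negb_and ys.
Qed.

Lemma sun_arc_neq (x y : T) : (1 < size s)%N -> sun_arc x y -> x != y.
Proof.
move=> s2 /orP[/andP[xs /eqP ->]|/andP[/eqP -> ys]]; first by rewrite eq_sym next_neq.
by apply: contraNneq ys => <-.
Qed.

End Sun.

(** * Bridges of a unicyclic graph *)

(** Serves to show that a walk from [u] survives the deletion of another edge, by following it
    vertex by vertex. *)
Lemma connect_ind_right (T : finType) (e : rel T) (u : T) (P : T -> Prop) :
  P u -> (forall z w, connect e u z -> P z -> e z w -> P w) ->
  forall z, connect e u z -> P z.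
Proof.
move=> Pu step z /connectP[p + ->]; elim/last_ind: p => [//|p w IH].
rewrite rcons_path last_rcons => /andP[up zw]; apply: step (IH up) zw.
by apply/connectP; exists p.
Qed.

Lemma eq_set2 (T : finType) (a b c d : T) :
  [set a; b]%SET = [set c; d]%SET -> (a = c /\ b = d) \/ (a = d /\ b = c).
Proof.
move=> E; have : a \in [set c; d]%SET by rewrite -E set21.
have : b \in [set c; d]%SET by rewrite -E set22.
have : c \in [set a; b]%SET by rewrite E set21.
have : d \in [set a; b]%SET by rewrite E set22.
rewrite !inE.
by do 4![case/orP => /eqP ?]; subst; auto.

Qed.

(** Two vertices giving the same edge would be each other's successor, impossible beyond length 2.
    Hence the edge set determines the length of a cycle. *)
Lemma card_cycle_edges (G : sgraph) (c : seq G) :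
  graph_cycle c -> #|cycle_edges c| = size c.
Proof.
case/andP=> c2 /andP[_ uc]; rewrite card_in_imset => [|v w vc wc].
  exact/card_uniqP.
case/eq_set2 => [[] //|[vE wE]].
by have := next_next_neq uc c2 wc; rewrite -vE wE eqxx.
Qed.

Section Unicyclic.
Variables (G : sgraph) (c : seq G).
Hypotheses (cG : connected_graph G) (cc : graph_cycle c).
Hypothesis c_only : forall c' : seq G, graph_cycle c' -> cycle_edges c' = cycle_edges c.

Definition delete_edge (a b : G) : rel G :=
  fun x y => adj x y && ([set x; y]%SET != [set a; b]%SET).

Lemma delete_edge_sym a b : symmetric (delete_edge a b).
Proof. by move=> x y; rewrite /delete_edge adj_sym setUC. Qed.

Lemma delete_edgeC a b : delete_edge a b = delete_edge b a.
Proof. by rewrite /delete_edge setUC. Qed.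

Lemma cycle_uniq : uniq c.
Proof. by case/andP: cc => _ /andP[]. Qed.

Lemma cycle_adj x : x \in c -> adj x (next c x).
Proof. by case/andP: cc => _ /andP[cyc _]; apply: next_cycle. Qed.

Lemma mem_cycle_edges x : x \in c -> [set x; next c x]%SET \in cycle_edges c.
Proof. by move=> xc; apply/imsetP; exists x. Qed.

(** A path from [a] to [b] avoiding the edge would close up with it to a cycle, whose edges are
    those of [c]. *)
Lemma noncycle_edge_bridge a b : adj a b -> [set a; b]%SET \notin cycle_edges c ->
  ~~ connect (delete_edge a b) a b.
Proof.
move=> ab; apply: contra => /connectP[p pp E].
case: (shortenP pp) E => q qq uq _ E.
have aq : path (@adj G) a q by apply: sub_path qq => x y /andP[].
have cyc : graph_cycle (a :: q).
  rewrite /graph_cycle /ucycleb uq andbT /= rcons_path aq -E adj_sym ab andbT.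
  (* The path has at least two edges: a single one would be the deleted edge. *)
  case: q qq E {aq uq} => [|x [|y q]] //= qq E; first by rewrite E adj_irr in ab.
  by move: qq; rewrite -E /delete_edge eqxx andbF.
(* As [b] ends the path, its successor on the closed cycle is [a]. *)
rewrite -(c_only cyc); apply/imsetP; exists b; first by rewrite E mem_last.
rewrite [RHS]setUC; congr [set _; _]%SET.
move: uq; rewrite E; case/lastP: q {qq E aq cyc} => [|q x]; first by rewrite /= eqxx.
rewrite last_rcons -rcons_cons rcons_uniq => /andP[xq uq].
rewrite next_nth mem_rcons mem_head -cats1 index_cat (negPf xq) /= eqxx addn0.
by rewrite nth_default // size_cat addn1.
Qed.

Lemma delete_noncycle_edge a b x y : [set a; b]%SET \notin cycle_edges c ->
  x \in c -> y \in c -> connect (delete_edge a b) x y.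
Proof.
move=> ab xc; have step z : z \in c -> delete_edge a b z (next c z).
  move=> zc; rewrite /delete_edge cycle_adj //=.
  by apply: contraNneq ab => <-; apply: mem_cycle_edges.
have [i p Ep] := rot_to xc.
rewrite -(mem_rot i) Ep => yp; apply: (@path_connect _ _ x p) => //.
have : path.cycle (delete_edge a b) c.
  by apply: cycle_from_next; [exact: cycle_uniq | exact: step].
by rewrite -(rot_cycle i) Ep /= rcons_path => /andP[].
Qed.

Variable u : G.

(** An edge outside [c] directed away from [u]: its deletion cuts the far end [b] off from [u]. *)
Definition far_arc (a b : G) : bool :=
  [&& adj a b, [set a; b]%SET \notin cycle_edges c &
      ~~ connect (delete_edge a b) u b].

(** If [u] reached neither end after the deletion, no walk from [u] could ever use the edge, and [G]
    would not be connected. *)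
Lemma far_arcP a b : far_arc a b ->
  [/\ adj a b, [set a; b]%SET \notin cycle_edges c,
      ~~ connect (delete_edge a b) u b & connect (delete_edge a b) u a].
Proof.
case/and3P => ab abc ub; split=> //; apply: contraNT ub => ua.
have [//|ub] := boolP (connect (delete_edge a b) u b).
rewrite -(negbTE ub); move: (cG u b).
apply: (connect_ind_right (P := connect (delete_edge a b) u));
  first exact: connect0.
move=> z w _ uz zw.
have [E|ne] := eqVneq [set z; w]%SET [set a; b]%SET.
  have [[za _]|[zb _]] := eq_set2 E; first by case/negP: ua; move: uz; rewrite za.
  by case/negP: ub; move: uz; rewrite zb.
by apply: connect_trans uz (connect1 _); rewrite /delete_edge zw.
Qed.

Lemma far_arc_neq a b : far_arc a b -> b != u.
Proof. by case/and3P => _ _; apply: contraNneq => ->; apply: connect0. Qed.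

(** An edge outside [c] is a bridge, so [u] cannot reach both of its ends once it is deleted. *)
Lemma far_arc_orient a b : adj a b ->
  [\/ a \in c /\ b = next c a, b \in c /\ a = next c b, far_arc a b | far_arc b a].
Proof.
move=> ab; have [abc|abc] := boolP ([set a; b]%SET \in cycle_edges c).
  have [x xc /eq_set2 [[-> ->]|[-> ->]]] := imsetP abc.
    by apply: Or41.
  by apply: Or42.
have [ub|ub] := boolP (connect (delete_edge a b) u b); last first.
  by apply: Or43; rewrite /far_arc ab abc ub.
apply: Or44; rewrite /far_arc adj_sym ab setUC abc delete_edgeC /=.
apply: contra (noncycle_edge_bridge ab abc) => ua.
by apply: connect_trans ub; rewrite (sym_connect_sym (delete_edge_sym a b)).
Qed.

(** A walk from [u] to [a'] avoiding the edge [a'b] never meets [b], so it also avoids [ab]. If [a]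
    and [a'] differed, [a'b] would extend it to [b] without using [ab]. *)
Lemma far_arc_uniq a a' b : far_arc a b -> far_arc a' b -> a = a'.
Proof.
case/far_arcP => ab _ ub _ /far_arcP[a'b _ ub' ua'].
apply: contraNeq ub => aa'; have ua : connect (delete_edge a b) u a'.
  move: ua'.
  apply: (connect_ind_right (P := connect (delete_edge a b) u));
    first exact: connect0.
  move=> z w uz' uz zw.
  have uw' := connect_trans uz' (connect1 zw).
  have [/eq_set2 [[_ wb]|[zb _]]|ne] := eqVneq [set z; w]%SET [set a; b]%SET.
  - by case/negP: ub'; move: uw'; rewrite wb.
  - by case/negP: ub'; move: uz'; rewrite zb.
  apply: connect_trans uz (connect1 _); case/andP: zw => zw _.
  by rewrite /delete_edge zw.
apply: connect_trans ua (connect1 _); rewrite /delete_edge a'b /=.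
by apply: contra_neq aa' => /eq_set2 [[]|[-> ->]].
Qed.

(** All of [c] lies beyond [ab], so a walk from [u] to [a] misses [b'] and hence the edge [a'b']. If
    the edges differ, it continues over [ab] and along [c] to [b'], a contradiction. *)
Lemma far_arc_cycle_uniq a b a' b' : far_arc a b -> far_arc a' b' ->
  b \in c -> b' \in c -> b = b'.
Proof.
case/far_arcP => ab abc ub ua /far_arcP[a'b' abc' ub' _] bc bc'.
have nc z : z \in c -> ~~ connect (delete_edge a b) u z.
  move=> zc; apply: contra ub => uz; apply: connect_trans uz _.
  exact: delete_noncycle_edge.
have ua' : connect (delete_edge a' b') u a.
  move: ua.
  apply: (connect_ind_right (P := connect (delete_edge a' b') u));
    first exact: connect0.
  move=> z w uz' uz zw.
  have uw' := connect_trans uz' (connect1 zw).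
  have [/eq_set2 [[_ wb]|[zb _]]|ne] := eqVneq [set z; w]%SET [set a'; b']%SET.
  - by have := nc b' bc'; rewrite -wb uw'.
  - by have := nc b' bc'; rewrite -zb uz'.
  apply: connect_trans uz (connect1 _); case/andP: zw => zw _.
  by rewrite /delete_edge zw.
have [/eq_set2 [[] //|[aE _]]|ne] := eqVneq [set a; b]%SET [set a'; b']%SET.
  by have := nc b' bc'; rewrite -aE ua.
case/negP: ub'; apply: connect_trans (delete_noncycle_edge abc' bc bc').
by apply: connect_trans ua' (connect1 _); rewrite /delete_edge ab.
Qed.

Lemma far_arc_cycle a b : u \in c -> far_arc a b -> b \notin c.
Proof.
move=> uc /and3P[_ abc ub]; apply: contra ub => bc.
exact: delete_noncycle_edge.
Qed.

(* [r] is the cycle vertex nearest to [u]. *)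
Lemma exists_gate : exists r, [/\ r \in c, u \in c -> r = u &
  forall a b, far_arc a b -> b \in c -> b = r].
Proof.
have [uc|uc] := boolP (u \in c).
  by exists u; split=> // a b ab bc; case/negP: (far_arc_cycle uc ab).
(* Off the cycle, [r] is a cycle vertex that is a far end; if none is found, the last claim is
   vacuous and any vertex of [c] serves. *)
have [b /andP[bc /existsP[a ab]]|none] :=
  pickP [pred b | (b \in c) && [exists a, far_arc a b]].
  by exists b; split=> // a' b' ab' bc'; apply: far_arc_cycle_uniq ab' ab bc' bc.
have : (0 < size c)%N by case/andP: cc => /ltnW/ltnW.
case E : c => [//|r p] _; exists r; rewrite mem_head -E; split=> //.
move=> a b ab bc; have /existsP ex : exists a, far_arc a b by exists a.
by have := none b; rewrite /= bc ex.
Qed.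

End Unicyclic.

(** * Comparison of the quadratic forms *)

Section EdgeEnergy.
Variables (R : realType) (alpha : R).
Hypothesis alpha01 : 0 <= alpha <= 1.

Lemma edge_energyC a b : edge_energy alpha a b = edge_energy alpha b a.
Proof. by rewrite /edge_energy; ring. Qed.

Lemma edge_energy_mono a a' b b' : 0 <= a <= a' -> 0 <= b <= b' ->
  edge_energy alpha a b <= edge_energy alpha a' b'.
Proof.
case/andP: alpha01 => al0 al1 /andP[a0 aa] /andP[b0 bb].
have [a'0 b'0] : 0 <= a' /\ 0 <= b' by split; [apply: le_trans aa | apply: le_trans bb].
apply: lerD; first by rewrite ler_wpM2l // lerD // ler_pXn2r.
by rewrite lerMn2r ler_wpM2l ?subr_ge0 // ler_pM.
Qed.

Lemma edge_energy_ge0 a b : 0 <= a -> 0 <= b -> 0 <= edge_energy alpha a b.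
Proof.
move=> a0 b0; have : edge_energy alpha 0 0 <= edge_energy alpha a b.
  by apply: edge_energy_mono; rewrite lexx.
by rewrite [X in X <= _](_ : _ = 0) // /edge_energy; ring.
Qed.

Variables (G : sgraph) (arc : rel G) (x : G -> R).
Hypothesis x0 : forall v, 0 <= x v.

Let arcsum := \sum_v \sum_(w | arc v w) edge_energy alpha (x v) (x w).

(** Symmetrises the sum over arcs, for comparison with [energyE] pair by pair. *)
Lemma arcsum_double : arcsum *+ 2 =
  \sum_v \sum_w ((if arc v w then edge_energy alpha (x v) (x w) else 0) +
                 (if arc w v then edge_energy alpha (x v) (x w) else 0)).
Proof.
rewrite mulr2n {2}/arcsum; under [X in _ = X]eq_bigr do rewrite big_split.
rewrite big_split /=; congr (_ + _).
  by apply: eq_bigr => v _; rewrite big_mkcond.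
rewrite exchange_big /=; apply: eq_bigr => v _; rewrite big_mkcond /=.
by apply: eq_bigr => w _; rewrite edge_energyC.
Qed.

Lemma energy_le_arcsum : (forall v w, adj v w -> arc v w || arc w v) ->
  energy alpha x <= arcsum.
Proof.
move=> cover; rewrite -(ler_pMn2r (isT : 0 < 2)%N) energyE arcsum_double.
apply: ler_sum => v _; rewrite big_mkcond; apply: ler_sum => w _.
have E0 := edge_energy_ge0 (x0 v) (x0 w).
case: ifP => [/cover|_]; last by rewrite addr_ge0 //; case: ifP.
by case: (arc v w) (arc w v) => [] [] //= _; rewrite ?addr0 ?add0r // lerDl.
Qed.

Lemma arcsum_le_energy : (forall v w, arc v w -> adj v w && ~~ arc w v) ->
  arcsum <= energy alpha x.
Proof.
move=> orient; rewrite -(ler_pMn2r (isT : 0 < 2)%N) energyE arcsum_double.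
apply: ler_sum => v _; rewrite [leRHS]big_mkcond; apply: ler_sum => w _.
have E0 := edge_energy_ge0 (x0 v) (x0 w).
have [vw|_] := boolP (arc v w).
  by have /andP[-> /negPf ->] := orient v w vw; rewrite addr0.
have [wv|_] := boolP (arc w v); last by rewrite addr0; case: ifP.
by have /andP[wv' _] := orient w v wv; rewrite adj_sym wv' add0r.
Qed.

End EdgeEnergy.

(** * Moving [u] onto the cycle and attaching all other vertices to it *)

Section Comparison.
Variables (R : realType) (alpha : R) (G : sgraph) (c : seq G).
Hypothesis alpha01 : 0 <= alpha <= 1.
Hypotheses (cG : connected_graph G) (cc : graph_cycle c).
Hypothesis c_only : forall c' : seq G, graph_cycle c' -> cycle_edges c' = cycle_edges c.
Variables (u r : G) (x : G -> R).
Hypotheses (rc : r \in c) (ur : u \in c -> r = u).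
Hypothesis far_r : forall a b, far_arc c u a b -> b \in c -> b = r.
Hypotheses (x0 : forall v, 0 <= x v) (xu : forall v, x v <= x u).

Definition swapped_cycle : seq G := map (tperm r u) c.

Local Notation s := swapped_cycle.

Lemma swapped_cycle_uniq : uniq s.
Proof. by rewrite map_inj_uniq ?(cycle_uniq cc) //; apply: perm_inj. Qed.

Lemma size_swapped_cycle : size s = size c.
Proof. exact: size_map. Qed.

Lemma swapped_cycle_gt2 : (2 < size s)%N.
Proof. by rewrite size_map; case/andP: cc. Qed.

Lemma mem_swapped_cycle : u \in s.
Proof. by apply/mapP; exists r; rewrite ?tpermL. Qed.

Lemma next_swapped_cycle v : next s (tperm r u v) = tperm r u (next c v).
Proof. by rewrite next_map //; [exact: perm_inj | exact: (cycle_uniq cc)]. Qed.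

(** On [c] only [r] can be a far end, and the swap puts [u], which is never a far end, in its
    place. *)
Lemma far_arc_swapped a b : far_arc c u a b -> b \notin s.
Proof.
move=> ab; apply/mapP => -[z zc bE]; have bu := far_arc_neq ab.
case: tpermP bE => [zr bE|zu bE|zr zu bE].
- by rewrite bE eqxx in bu.
- by move: bu; rewrite bE ur ?eqxx // -zu.
- by case: zr; apply: (far_r (a := a)) zc; rewrite -bE.
Qed.

Lemma cycle_energy_le :
  \sum_(v in c) edge_energy alpha (x v) (x (next c v)) <=
  \sum_(v in s) edge_energy alpha (x v) (x (next s v)).
Proof.
rewrite [leRHS](reindex_inj (@perm_inj _ (tperm r u))) /=.
rewrite [leRHS](eq_bigl (mem c)) => [|v]; last by rewrite mem_map //; apply: perm_inj.
have le v : v \in c -> 0 <= x v <= x (tperm r u v).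
  move=> vc; rewrite x0 /=; case: tpermP => [_|vu|//]; first exact: xu.
  by rewrite ur -?vu.
apply: ler_sum => v vc; rewrite next_swapped_cycle edge_energy_mono ?le //.
by rewrite mem_next.
Qed.

(** Each far end has a single near end, whose value is at most [x u]; vertices off [s] that are no
    far ends only add nonnegative terms. *)
Lemma far_energy_le :
  \sum_v \sum_(w | far_arc c u v w) edge_energy alpha (x v) (x w) <=
  \sum_(w | w \notin s) edge_energy alpha (x u) (x w).
Proof.
rewrite (exchange_big_dep xpredT) //= [leRHS]big_mkcond; apply: ler_sum => w _.
have [a aw|none] := pickP (fun v => far_arc c u v w); last first.
  by rewrite big_pred0 //; case: ifP => // _; apply: edge_energy_ge0.
rewrite (far_arc_swapped aw) (big_pred1 a) => [|v].
  by rewrite edge_energy_mono // x0 ?xu ?lexx.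
apply/idP/eqP => [vw|-> //]; exact: far_arc_uniq vw aw.
Qed.

Lemma energy_le_sun : energy alpha x <= energy alpha (x : sun s u -> R).
Proof.
(* Cycle edges are directed along [next], all others away from [u]; covering every edge of [G]
   suffices for the upper bound. *)
pose arc v w := (v \in c) && (w == next c v) || far_arc c u v w.
have [us su s2] := And3 swapped_cycle_uniq mem_swapped_cycle swapped_cycle_gt2.
apply: le_trans (energy_le_arcsum alpha01 (arc := arc) x0 _) _ => [v w vw|].
  rewrite /arc; case: (far_arc_orient c_only u vw) => [[-> ->]|[-> ->]|->|->];
  by rewrite ?eqxx ?orbT.
apply: le_trans
  (arcsum_le_energy alpha01 (G := sun s u) (arc := sun_arc s u) x0 _); last first.
  move=> v w vw; have vw' := sun_arc_excl us su s2 vw.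
  by rewrite vw' andbT /adj /= /sun_adj vw andbT (sun_arc_neq us su _ vw) // ltnW.
(* In both graphs cycle arcs and the remaining arcs are disjoint, so the two parts can be compared
   separately. *)
have arcsumE (t : seq G) (far : rel G) :
    (forall v w, v \in t -> far v w -> w != next t v) ->
    \sum_v \sum_(w | (v \in t) && (w == next t v) || far v w)
      edge_energy alpha (x v) (x w) =
    \sum_(v in t) edge_energy alpha (x v) (x (next t v)) +
    \sum_v \sum_(w | far v w) edge_energy alpha (x v) (x w).
  move=> dis; rewrite [X in _ = X + _]big_mkcond -big_split /=; apply: eq_bigr => v _.
  case: ifP => [vt|vt]; last by rewrite add0r.
  rewrite (bigD1 (next t v)) ?eqxx //=; congr (_ + _); apply: eq_bigl => w.
  case: eqVneq => [->|_] /=; last by rewrite andbT.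
  by apply/esym/negP => /(dis _ _ vt); rewrite eqxx.
rewrite /arc arcsumE => [|v w vc]; last first.
  move=> vw; apply/eqP => wE; have := far_arc_swapped vw.
  case/and3P: vw => _ /negP[]; rewrite wE; exact: mem_cycle_edges.
rewrite [leRHS]arcsumE => [|v w vs /andP[_ ws]]; last first.
  by apply: contraNneq ws => ->; rewrite mem_next.
rewrite lerD ?cycle_energy_le //; apply: le_trans far_energy_le _.
rewrite [leRHS](bigD1 u) //= [X in _ + X]big1 ?addr0 => [|v /negPf vu].
  by under [leRHS]eq_bigl do rewrite eqxx.
by rewrite big_pred0 // => w; rewrite vu.
Qed.

Lemma swapped_cycle_id : u \in c -> s = c.
Proof.
by move=> uc; rewrite /s (ur uc) -[RHS]map_id; apply: eq_map => v; rewrite tperm1 perm1.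
Qed.

Lemma far_arc_from v : adj u v -> (u \in c -> v \notin c) -> far_arc c u u v.
Proof.
move=> uv nuv; case: (far_arc_orient c_only u uv) => //.
- by case=> uc vE; have := nuv uc; rewrite vE mem_next uc.
- by case=> vc uE; have := nuv; rewrite uE mem_next vc => /(_ isT).
- by move=> /far_arc_neq; rewrite eqxx.
Qed.

(** A cycle edge at [u] puts [u] on [c], where [s = c]; any other edge at [u] leads to a far end,
    which is pendant at [u] in the sun. *)
Lemma adj_sun_adj v : adj u v -> sun_adj s u u v.
Proof.
move=> uv; have nuv : u != v by apply: contraTneq uv => ->; rewrite adj_irr.
rewrite /sun_adj nuv /=.
case: (far_arc_orient c_only u uv) => [[uc E]|[vc E]|/far_arc_swapped vs|/far_arc_neq].
- by rewrite swapped_cycle_id // /sun_arc uc E eqxx.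
- by rewrite swapped_cycle_id ?E ?mem_next // /sun_arc vc eqxx orbT.
- by rewrite /sun_arc eqxx vs orbT.
- by rewrite eqxx.
Qed.

(** If [u] were off [c], its successor on [s] would be a neighbour in [G], hence a far end and off
    [s]. So [s = c]; every vertex off [c] is then adjacent to [u], which is its only near end. *)
Lemma adj_eq_sun : (forall v, sun_adj s u u v -> adj u v) ->
  forall v w, adj v w = sun_adj s u v w.
Proof.
move=> inv.
have us := swapped_cycle_uniq; have s2 := swapped_cycle_gt2.
have su := mem_swapped_cycle.
have uc : u \in c.
  have rE : u = tperm r u r by rewrite tpermL.
  have [//|uc] := boolP (u \in c).
  have arc : sun_arc s u u (next s u) by rewrite /sun_arc su eqxx.
  have uv : adj u (next s u).
    by apply: inv; rewrite /sun_adj (sun_arc_neq us su _ arc) ?arc // ltnW.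
  have /far_arc_swapped : far_arc c u u (next s u).
    by apply: far_arc_from => // uc'; rewrite uc' in uc.
  by rewrite mem_next su.
have sE := swapped_cycle_id uc; rewrite sE in inv us s2 su *.
have arcE v w : sun_arc c u v w -> adj v w.
  case/orP => [/andP[vc /eqP ->]|/andP[/eqP -> wc]]; first exact: cycle_adj.
  apply: inv; rewrite /sun_adj /sun_arc eqxx wc orbT andbT.
  by apply: contraNneq wc => <-.
move=> v w; apply/idP/andP => [vw|[_ /orP[/arcE //|/arcE]]]; last by rewrite adj_sym.
split; first by apply: contraTneq vw => ->; rewrite adj_irr.
have farE a b : far_arc c u a b -> sun_arc c u a b.
  move=> ab; have bc := far_arc_cycle cc uc ab.
  have ub : adj u b.
    by apply: arcE; rewrite /sun_arc eqxx bc orbT.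
  have /(far_arc_uniq cG ab) -> : far_arc c u u b by apply: far_arc_from.
  by rewrite /sun_arc eqxx bc orbT.
case: (far_arc_orient c_only u vw) => [[vc ->]|[wc ->]|/farE ->|/farE ->];
  by rewrite ?orbT // /sun_arc ?vc ?wc eqxx ?orbT.
Qed.

End Comparison.

(** * The bound and its case of equality *)

Lemma graph_iso_trans (G H K : sgraph) :
  graph_iso G H -> graph_iso H K -> graph_iso G K.
Proof.
case=> f [bf fE] [h [bh hE]]; exists (h \o f); split; first exact: bij_comp.
by move=> x y; rewrite hE fE.
Qed.

Lemma unicyclic_rho_le (R : realType) (alpha : R) (G : sgraph) (c : seq G) :
  0 <= alpha <= 1 -> connected_graph G -> graph_cycle c ->
  (forall c' : seq G, graph_cycle c' -> cycle_edges c' = cycle_edges c) ->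
  rho alpha G <= rho alpha (Un #|G| (size c)) /\
  (rho alpha G = rho alpha (Un #|G| (size c)) -> graph_iso G (Un #|G| (size c))).
Proof.
move=> ha cG cc c_only.
have G0 : (0 < #|G|)%N.
  have : (0 < size c)%N by case/andP: cc => /ltnW/ltnW.
  by case: (c) => [//|v ?] _; apply/card_gt0P; exists v.
have [x [x0 [v0 xv0] xE]] := rho_nneg_eigenfunction ha G0.
pose u := [arg max_(v > v0) x v]%O.
have xu v : x v <= x u by rewrite /u; case: arg_maxP => // w _; apply.
have xu0 : 0 < x u by apply: lt_le_trans (xu v0).
have [r [rc ur far_r]] := exists_gate cG cc u.
set s := swapped_cycle c u r.
have iso : graph_iso (sun s u) (Un #|G| (size c)).
  rewrite -(size_swapped_cycle c u r); apply: sun_iso_Un.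
    exact: swapped_cycle_uniq.
  exact: mem_swapped_cycle.
have rhoE := graph_iso_rho (G := sun s u) alpha G0 iso; rewrite -rhoE.
have x2 : 0 < \sum_v x v ^+ 2.
  by rewrite (bigD1 u) //= ltr_wpDr ?exprn_gt0 // sumr_ge0 // => *; rewrite sqr_ge0.
have eG : energy alpha x = rho alpha G * \sum_v x v ^+ 2.
  by apply/eqP; rewrite (rho_leif alpha x G0).2; apply/forallP => v; rewrite xE.
have leS := energy_le_sun ha cG cc c_only rc ur far_r x0 xu.
have [leH eqH] := @rho_leif _ alpha (sun s u) x G0.
split; first by rewrite -(ler_pM2r x2) -eG (le_trans leS).
move=> rhoGH.
(* With equal [rho], [x] attains the Rayleigh bound of the sun as well. *)
have xS v : @Aalpha_op _ (sun s u) alpha x v = rho alpha G * x v.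
  apply/eqP; rewrite rhoGH; move: v; apply/forallP; rewrite -eqH eq_le leH /=.
  by rewrite -rhoGH -eG.
(* For [alpha = 0] this needs [x w > 0]: if [x w = 0], the eigenvalue equation at [w] would have a
   zero right side, while its left side is at least [x u]. *)
have pos w : sun_adj s u u w -> 0 < alpha * x u + (1 - alpha) * x w.
  move=> uw; case/andP: ha; rewrite le_eqVlt => /orP[/eqP a0|a0] a1; last first.
    by rewrite ltr_pwDl ?mulr_gt0 ?mulr_ge0 ?subr_ge0.
  rewrite -a0 mul0r add0r subr0 mul1r lt0r x0 andbT; apply/eqP => xw.
  have := xS w; rewrite xw mulr0 => /eqP; apply/negP; rewrite gt_eqF //.
  rewrite /Aalpha_op (bigD1 u) /=; last by rewrite sun_adj_sym.
  rewrite -a0 mul0r add0r subr0 mul1r ltr_pwDl // sumr_ge0 // => w' _.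
  by rewrite add0r mul1r.
suff inv w : sun_adj s u u w -> adj u w.
  apply: graph_iso_trans iso; exists id; split; first by exists id.
  by move=> v w; rewrite (adj_eq_sun cG cc c_only rc ur far_r).
move=> uw; apply: contraT => nuw.
(* A new neighbour [w] adds a positive term at [u], though both sides equal [rho alpha G * x u]. *)
have : Aalpha_op alpha x u < @Aalpha_op _ (sun s u) alpha x u.
  rewrite /Aalpha_op [ltRHS](bigID (adj u)) /=
    [ltLHS](eq_bigl (fun v => sun_adj s u u v && adj u v)).
    rewrite ltrDl (bigD1 w) /= ?uw // ltr_pwDl ?pos // sumr_ge0 //.
    move=> v /andP[/andP[uv _] _].
    exact/ltW/pos.
  move=> v /=; case uv: (adj u v); rewrite ?andbF // andbT.
  by rewrite (adj_sun_adj c_only ur far_r).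
by rewrite xE xS ltxx.
Qed.

Theorem theorem3p2 (R : realType) (alpha : R) (G : sgraph) (n g : nat)
    (halpha : 0 <= alpha <= 1) (hn : #|G| = n) (hG : unicyclic G)
    (hgirth : has_girth G g) (hg : (3 <= g)%N) :
  rho alpha G <= rho alpha (Un n g) /\
  (rho alpha G = rho alpha (Un n g) <-> graph_iso G (Un n g)).
Proof.
have [cG [c cc c_only]] := hG.
(* A cycle of length [g] has the edge set of [c], hence its length. *)
have <- : size c = g.
  have [[c' cc' <-] _] := hgirth.
  by rewrite -!card_cycle_edges // (c_only c').
rewrite -hn; have [le_rho eq_rho] := unicyclic_rho_le halpha cG cc c_only.
split=> //; split=> // iso; apply: graph_iso_rho iso.
have : (0 < size c)%N by case/andP: cc => /ltnW/ltnW.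
by case: (c) => [//|v ?] _; apply/card_gt0P; exists v.
Qed.
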